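(* Let $\kappa$ be an infinite regular cardinal. (a) If $X$ is a $T_1$ space with $odL(X)\le\kappa$, then the subspace $Z$ of non-isolated points of $X$ satisfies $\ell L(Z)\le\kappa$ (i.e. $Z$ is linearly Lindelöf$_\kappa$). (b) If $X$ is a topological space whose subspace $Z$ of non-isolated points satisfies $L(Z)\le\kappa$ (i.e. $Z$ is Lindelöf$_\kappa$), then $odL(X)\le\kappa$ (i.e. $X$ is od-Lindelöf$_\kappa$). (c) A $T_1$ space $X$ is od-compact if and only if the subspace of its non-isolated points is compact.
   Context: For a topological space $X$: $L(X)$ is the smallest cardinal $\kappa$ such that every open cover of $X$ has a subcover of cardinality $<\kappa$; $\ell L(X)$ is the smallest cardinal $\kappa$ such that every open cover of $X$ which is a chain for inclusion has a subcover of cardinality $<\kappa$; $odL(X)$ is the smallest cardinal $\kappa$ such that every cover of $X$ by open dense subsets of $X$ has a subcover of cardinality $<\kappa$. $X$ is Lindelöf$_\kappa$ if $L(X)\le\kappa$, linearly Lindelöf$_\kappa$ if $\ell L(X)\le\kappa$, od-Lindelöf$_\kappa$ if $odL(X)\le\kappa$. Compact means $L(X)\le\omega$ and od-compact means $odL(X)\le\omega$ (no separation axiom is included). A point $x\in X$ is isolated if $\{x\}$ is open in $X$. *)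

(* Defs.v *)
From mathcomp Require Import all_boot all_classical.
From mathcomp Require Import topology.

Set Implicit Arguments.
Unset Strict Implicit.
Unset Printing Implicit Defensive.

Local Open Scope classical_set_scope.
Local Open Scope card_scope.

(* A cardinal is represented by a type [K] of that cardinality; cardinals are
   compared by [#<=] on full sets, and nothing below distinguishes equipotent
   types. *)

Definition card_lt T U (A : set T) (B : set U) : Prop :=
  (A #<= B) /\ ~ (B #<= A).

(* [K] is not the sum of fewer than [K] cardinals, each smaller than [K]. *)
Definition regular_cardinal (K : Type) : Prop :=
  forall F : set (set K),
    card_lt F [set: K] ->
    (forall A, F A -> card_lt A [set: K]) ->
    \bigcup_(A in F) A <> [set: K].

Definition smallest_cardinal (P : Type -> Prop) (M : Type) : Prop :=
  P M /\ forall N : Type, P N -> [set: M] #<= [set: N].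

Definition is_cover (X : Type) (U : set (set X)) : Prop :=
  \bigcup_(A in U) A = [set: X].

Definition has_subcover_lt (X : Type) (U : set (set X)) (K : Type) : Prop :=
  exists V : set (set X), [/\ V `<=` U, is_cover V & card_lt V [set: K]].

Section CoveringNumbers.
Variable X : topologicalType.

Definition is_L : Type -> Prop :=
  smallest_cardinal (fun K => forall U : set (set X),
    U `<=` open -> is_cover U -> has_subcover_lt U K).

Definition is_ellL : Type -> Prop :=
  smallest_cardinal (fun K => forall U : set (set X),
    U `<=` open -> total_on U subset -> is_cover U -> has_subcover_lt U K).

Definition is_odL : Type -> Prop :=
  smallest_cardinal (fun K => forall U : set (set X),
    U `<=` open -> U `<=` @dense X -> is_cover U -> has_subcover_lt U K).

Variable K : Type.

Definition Lindelof : Prop :=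
  exists2 M : Type, is_L M & [set: M] #<= [set: K].

Definition linearly_Lindelof : Prop :=
  exists2 M : Type, is_ellL M & [set: M] #<= [set: K].

Definition od_Lindelof : Prop :=
  exists2 M : Type, is_odL M & [set: M] #<= [set: K].

End CoveringNumbers.

Definition L_compact (X : topologicalType) : Prop := Lindelof X nat.

Definition od_compact (X : topologicalType) : Prop := od_Lindelof X nat.

Definition isolated_point (X : topologicalType) (x : X) : Prop :=
  open [set x].

(* The sigma type of the non-isolated points, with the subspace topology of
   topology_theory/subtype_topology.v. *)
Definition nonisolated (X : topologicalType) : topologicalType :=
  set_type [set x : X | ~ isolated_point x].

(* Main.v *)
(* An open dense set contains every isolated point, so such a cover only has to
   be thinned out on the non-isolated points; this gives (b).
   For (a), extend a chain cover of the non-isolated points by all isolated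
   points to a chain cover [U] of [X]. If some member is dense, so are all larger
   ones and od-Lindelöfness applies. Otherwise there is a relatively discrete
   set [D] of non-isolated points contained in no member of [U]. Closures of
   subsets of [D] have empty interior in a T1 space, so the sets
   [~` closure (D `\` A)], for [A] in [U], form an open dense cover; the indices
   [A] of a subcover are not bounded in [U] by any [B], since a point of
   [D `\` B] would be missed, and hence they cover [X].
   For (c), finite chain subcovers yield compactness. *)
Require Import Defs.
From mathcomp Require Import all_boot all_classical.
From mathcomp Require Import topology.

Set Implicit Arguments.
Unset Strict Implicit.
Unset Printing Implicit Defensive.

Local Open Scope classical_set_scope.
Local Open Scope card_scope.

(** * Comparability and least cardinals *)

(* Hönig's argument: a maximal set of choice functions on [F] that is separated
   by every evaluation at a member of [F] must evaluate onto some [A] in [F];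
   this [A] then injects into all the others. *)
Lemma ex_least_card (T : Type) (F : set (set T)) :
  F !=set0 -> exists2 A, F A & forall B, F B -> A #<= B.
Proof.
elim/Ppointed: T => T in F *.
  by case=> A FA; exists A => // B _; exact: card_le_emptyl.
move=> F0.
pose P (S : set (set T -> T)) :=
  (forall f A, S f -> F A -> A (f A)) /\
  (forall f g A, S f -> S g -> F A -> f A = g A -> f = g).
have [|S [[SA Sinj] Smax]] := @Zorn_bigcup _ P.
  move=> C CP Ctot; split=> [f A [S CS Sf] FA|f g A [S CS Sf] [S' CS' Sg]].
    exact: ((CP _ CS).1 f A).
  have [SS'|S'S] := Ctot _ _ CS CS'.
    by apply: (CP _ CS').2 => //; exact: SS'.
  by apply: (CP _ CS).2 => //; exact: S'S.
have [[A [FA onto]]|no] :=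
    pselect (exists A, F A /\ A `<=` (fun f => f A) @` S).
  exists A => // B FB.
  have AS : A #<= S.
    exact: card_le_trans (subset_card_le onto) (card_image_le _ _).
  apply: (card_le_trans AS).
  have injB : {in S &, injective (fun f : set T -> T => f B)}.
    by move=> f g /set_mem Sf /set_mem Sg; exact: Sinj.
  rewrite -(card_le_eql (inj_card_eq injB)).
  by apply: subset_card_le => _ [f Sf <-]; exact: (SA f B).
(* Otherwise some [g] avoids, at each [A] in [F], all values taken there by members of [S], and [g]
   can be added to [S]. Outside [F] its value is arbitrary. *)
have /choice[g gP] (A : set T) :
    exists t, F A -> A t /\ forall f, S f -> f A <> t.
  have [FA|nFA] := pselect (F A); last by exists point.
  apply: contrapT => /forallNP h; apply: no; exists A; split=> // t At.
  apply: contrapT => nt; apply: (h t) => _; split=> // f Sf ft.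
  by apply: nt; exists f.
have [A0 FA0] := F0.
have nSg : ~ S g by move=> Sg; exact: ((gP _ FA0).2 _ Sg).
exfalso; apply: (Smax (S `|` [set g])).
  by split; [left | move=> /(_ g (or_intror erefl))].
split=> [f A [Sf|->] FA|f h A [Sf|->] [Sh|->] FA fh //].
- exact: (SA f A).
- exact: (gP A FA).1.
- exact: (Sinj _ _ A).
- by case: ((gP _ FA).2 _ Sf).
- by case: ((gP _ FA).2 _ Sh).
Qed.

(** Copies of both types live in their sum, where one of the two copies has least cardinality. *)
Lemma card_le_total (T U : Type) :
  [set: T] #<= [set: U] \/ [set: U] #<= [set: T].
Proof.
have rl : range (@inl T U) #= [set: T] by apply: inj_card_eq => x y _ _ [].
have rr : range (@inr T U) #= [set: U] by apply: inj_card_eq => x y _ _ [].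
have [|A AF Amin] := @ex_least_card _ [set range (@inl T U); range (@inr T U)].
  by exists (range (@inl T U)); left.
case: AF Amin => -> Amin; [left|right].
  by rewrite -(card_le_eql rl) -(card_le_eqr rr); apply: Amin; right.
by rewrite -(card_le_eql rr) -(card_le_eqr rl); apply: Amin; left.
Qed.

(** This replaces a bound on a covering number by the covering property at [K] itself. The smallest
    cardinal is sought among the subsets of [K]: any other candidate is either at least [K] or
    equipotent to such a subset. *)
Lemma smallest_cardinal_leP (P : Type -> Prop) (K : Type) :
  (forall M N : Type, [set: M] #<= [set: N] -> P M -> P N) ->
  (exists2 M, smallest_cardinal P M & [set: M] #<= [set: K]) <-> P K.
Proof.
move=> Pmono; split=> [[M [PM _] MK]|PK]; first exact: Pmono PM.
have [|A PA Amin] := @ex_least_card K (fun A => P (set_type A)).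
  exists [set: K] => /=; apply: Pmono PK.
  by rewrite (card_le_eqr (card_setT _)).
exists (set_type A); last by rewrite (card_le_eql (card_setT _)) card_leT.
split=> // N PN; rewrite (card_le_eql (card_setT _)).
have [KN|] := card_le_total K N; first exact: card_le_trans (card_leT _) KN.
move=> /card_subP[B BN _].
rewrite -(card_le_eqr BN); apply: Amin; apply: Pmono PN.
by rewrite (card_le_eqr (card_setT _)) (card_le_eqr BN).
Qed.

Lemma card_le_lt_trans T U V (A : set T) (B : set U) (C : set V) :
  A #<= B -> card_lt B C -> card_lt A C.
Proof.
move=> AB [BC nCB]; split; first exact: card_le_trans BC.
by move=> /card_le_trans/(_ AB).
Qed.

Lemma card_lt_le_trans T U V (A : set T) (B : set U) (C : set V) :
  card_lt A B -> B #<= C -> card_lt A C.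
Proof.
move=> [AB nBA] BC; split; first exact: card_le_trans BC.
by move=> /(card_le_trans BC).
Qed.

Lemma finite_card_lt T U (A : set T) (B : set U) :
  finite_set A -> infinite_set B -> card_lt A B.
Proof.
move=> finA infB; split; last by move=> /card_le_finite/(_ finA).
apply: card_le_trans (finite_set_countable finA) _.
exact/infiniteP.
Qed.

Lemma card_lt_nat T (A : set T) : card_lt A [set: nat] <-> finite_set A.
Proof.
split=> [[_ nA]|finA]; first exact/finite_setPn.
exact/finite_card_lt/infinite_nat.
Qed.

(** * Covering numbers as covering properties *)

Lemma has_subcover_lt_le X (U : set (set X)) (M N : Type) :
  [set: M] #<= [set: N] -> has_subcover_lt U M -> has_subcover_lt U N.
Proof.
by move=> MN [V [VU Vc Vlt]]; exists V; split=> //; exact: card_lt_le_trans MN.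
Qed.

Section Characterizations.
Variables (X : topologicalType) (K : Type).

Lemma LindelofP : Lindelof X K <-> forall U : set (set X),
  U `<=` open -> is_cover U -> has_subcover_lt U K.
Proof.
apply: smallest_cardinal_leP => M N MN PM U Uo Uc.
exact: has_subcover_lt_le MN (PM U Uo Uc).
Qed.

Lemma linearly_LindelofP : linearly_Lindelof X K <-> forall U : set (set X),
  U `<=` open -> total_on U subset -> is_cover U -> has_subcover_lt U K.
Proof.
apply: smallest_cardinal_leP => M N MN PM U Uo Ut Uc.
exact: has_subcover_lt_le MN (PM U Uo Ut Uc).
Qed.

Lemma od_LindelofP : od_Lindelof X K <-> forall U : set (set X),
  U `<=` open -> U `<=` @dense X -> is_cover U -> has_subcover_lt U K.
Proof.
apply: smallest_cardinal_leP => M N MN PM U Uo Ud Uc.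
exact: has_subcover_lt_le MN (PM U Uo Ud Uc).
Qed.

End Characterizations.

(** * Thinning out open dense covers *)

Lemma dense_isolated (X : topologicalType) (A : set X) (x : X) :
  dense A -> isolated_point x -> A x.
Proof. by move=> dA /(dA _ (ex_intro _ x erefl))[_ [->]]. Qed.

(** Choosing one preimage for each member of the subcover gives a small set of indices in [U], so
    covers can be moved between a space and its subspace. *)
Lemma has_subcover_lt_image (X Y : Type) (U : set (set X))
    (f : set X -> set Y) (K : Type) :
  has_subcover_lt (f @` U) K ->
  exists C, [/\ C `<=` U, is_cover (f @` C) & card_lt C [set: K]].
Proof.
move=> [V [VU Vc Vlt]].
have /choice[g gP] (B : set Y) : exists A, V B -> U A /\ f A = B.
  have [/VU[A UA fA]|nVB] := pselect (V B); first by exists A.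
  by exists set0.
exists (g @` V); split.
- by move=> _ [B /gP[UA _] <-].
- suff -> : f @` (g @` V) = V by [].
  apply/seteqP; split=> [_ [_ [B VB <-] <-]|B VB]; first by rewrite (gP _ VB).2.
  by exists (g B); [exists B | exact: (gP _ VB).2].
- exact: card_le_lt_trans (card_image_le _ _) Vlt.
Qed.

Lemma ex_nonisolated (X : topologicalType) (x : X) :
  ~ isolated_point x -> exists z : nonisolated X, set_val z = x.
Proof.
move=> xi.
have xZ : x \in [set y : X | ~ isolated_point y] by exact: mem_set.
by exists (exist _ x xZ).
Qed.

Lemma Lindelof_nonisolated_od (X : topologicalType) (K : Type) :
  infinite_set [set: K] -> Lindelof (nonisolated X) K -> od_Lindelof X K.
Proof.
move=> infK /LindelofP LZ; apply/od_LindelofP => U Uo Ud Uc.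
pose r (A : set X) : set (nonisolated X) := set_val @^-1` A.
have [|C [CU Cc Clt]] := @has_subcover_lt_image _ _ U r K.
  apply: LZ.
    by move=> _ [A UA <-]; exists A => //; exact: Uo.
  apply/seteqP; split=> // z _.
  have [A UA Az] : (\bigcup_(A in U) A) (set_val z) by rewrite Uc.
  by exists (r A) => //; exists A.
have nonisoC (x : X) : ~ isolated_point x -> exists2 A, C A & A x.
  move=> /ex_nonisolated[z <-].
  have [_ [A CA <-] Az] : (\bigcup_(B in r @` C) B) z by rewrite Cc.
  by exists A.
have [C0|/set0P[A0 CA0]] := eqVneq C set0; last first.
  exists C; split=> //; apply/seteqP; split=> // x _.
  have [xi|/nonisoC[A CA Ax]] := pselect (isolated_point x); last by exists A.
  by exists A0 => //; exact: dense_isolated (Ud _ (CU _ CA0)) xi.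
(* With [C] empty every point is isolated, so any single dense member of [U] is all of [X]. *)
have iso (x : X) : isolated_point x.
  by apply: contrapT => /nonisoC[A]; rewrite C0.
have [U0|/set0P[A0 UA0]] := eqVneq U set0.
  by exists U; split=> //; rewrite U0; exact: finite_card_lt.
exists [set A0]; split; [by move=> _ -> | | exact: finite_card_lt].
apply/seteqP; split=> // x _; exists A0 => //.
exact: dense_isolated (Ud _ UA0) _.
Qed.

(** * Relatively discrete sets and chain covers *)

Lemma dense_closureC (X : topologicalType) (D : set X) :
  (forall W, open W -> W `<=` closure D -> W = set0) -> dense (~` closure D).
Proof.
move=> h W W0 Wo; apply: contrapT => nWD; move: W0; rewrite (h W) // => [[]//|].
by move=> x Wx; apply: contrapT => nx; apply: nWD; exists x.
Qed.

Lemma discrete_nonisolated_dense_closureC (X : topologicalType) (D : set X) :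
  accessible_space X ->
  (forall x, D x -> ~ isolated_point x) ->
  (forall x, D x -> exists2 O, open O & O `&` D = [set x]) ->
  dense (~` closure D).
Proof.
move=> T1 Dni Ddisc; apply: dense_closureC => W Wo WD.
have meet W' : open W' -> W' `<=` closure D -> W' !=set0 -> D `&` W' !=set0.
  by move=> W'o W'D [x W'x]; apply: (W'D x W'x); exact: open_nbhs_nbhs.
apply: contrapT => /eqP/set0P/(meet _ Wo WD)[d [Dd Wd]].
have [O Oo OD] := Ddisc _ Dd.
have [Od _] : (O `&` D) d by rewrite OD.
apply: (Dni _ Dd); rewrite /isolated_point.
suff -> : [set d] = W `&` O by exact: openI.
apply/seteqP; split=> [_ ->//|y [Wy Oy]] /=.
apply: contrapT => yd.
(* A second point [y] of the intersection of [W] and [O] would make that set minus [d] open (by T1)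
   and nonempty, so it would meet [D] at a point of [O] other than [d]. *)
have [|||e [De [[We Oe] ed]]] := meet ((W `&` O) `&` ~` [set d]).
- apply: openI; first exact: openI.
  exact/closed_openC/accessible_closed_set1.
- by move=> z [[/WD]].
- by exists y.
by apply: ed; rewrite -OD.
Qed.

(* A triple [(x, (V, W))] stands for a point [x] together with the open set
   [(~` V)° `&` W] isolating it. Comparing triples by [W] against the next [V]
   makes these open sets pairwise disjoint. *)
Definition gap_family (X : topologicalType) (U : set (set X))
    (S : set (X * (set X * set X))) : Prop :=
  (forall x V W, S (x, (V, W)) -> [/\ U V, U W, (~` V)° x & W x]) /\
  (forall s t, S s -> S t -> s <> t ->
    s.2.2 `<=` t.2.1 \/ t.2.2 `<=` s.2.1).

(** A maximal gap family works: if some [A] in [U] contained all its sets [W], then [A], not being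
    dense, would miss a neighbourhood of some [y], and the triple of [y], [A] and a member of [U]
    through [y] could be added. *)
Lemma ex_unbounded_gap_family (X : topologicalType) (U : set (set X)) :
  (forall A, U A -> ~ dense A) -> is_cover U ->
  exists2 S, gap_family U S &
    forall A, U A -> exists2 s, S s & ~ s.2.2 `<=` A.
Proof.
move=> Und Uc.
have [|S [SP Smax]] := @Zorn_bigcup _ (gap_family U).
  move=> C CP Ctot; split=> [x V W [S CS] |s t [S CS Ss] [S' CS' St]].
    exact: (CP _ CS).1.
  have [SS'|S'S] := Ctot _ _ CS CS'.
    by apply: (CP _ CS').2 => //; exact: SS'.
  by apply: (CP _ CS).2 => //; exact: S'S.
exists S => // A UA; apply: contrapT => bounded.
have {}bounded s : S s -> s.2.2 `<=` A.
  by move=> Ss; apply: contrapT => nsA; apply: bounded; exists s.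
have [y Ay] : (~` A)° !=set0.
  have [O [[y [Oo Oy]] OA]] := denseNE (Und _ UA).
  have OnA : O `<=` ~` A by rewrite subsets_disjoint setCK.
  by exists y; move: OnA; rewrite open_subsetE //; exact.
have [W UW Wy] : (\bigcup_(W in U) W) y by rewrite Uc.
pose t := (y, (A, W)).
have nSt : ~ S t by move=> /bounded/(_ _ Wy); exact: interior_subset Ay.
apply: (Smax (S `|` [set t])).
  by split; [left | move=> /(_ t (or_intror erefl))].
split=> [x V V' [/SP.1//|[-> -> ->]]//|s s' [Ss|->] [Ss'|->] ss' //].
- exact: SP.2.
- by left; exact: bounded.
- by right; exact: bounded.
Qed.

Lemma ex_unbounded_discrete (X : topologicalType) (U : set (set X)) :
  U `<=` open ->
  total_on U subset -> (forall A, U A -> @isolated_point X `<=` A) ->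
  (forall A, U A -> ~ dense A) -> is_cover U ->
  exists D : set X,
    [/\ forall x, D x -> ~ isolated_point x,
        forall x, D x -> exists2 O, open O & O `&` D = [set x] &
        forall A, U A -> ~ D `<=` A].
Proof.
move=> Uo Ut Ui Und Uc.
have [S [S1 S2] Sub] := @ex_unbounded_gap_family _ U Und Uc.
exists (fst @` S); split.
- move=> _ [[x [V W]] /S1[UV _ Vx _] <-] xi.
  exact: interior_subset Vx (Ui _ UV _ xi).
- move=> _ [[x [V W]] Ss <-]; have [UV UW Vx Wx] := S1 _ _ _ Ss.
  exists ((~` V)° `&` W).
    by apply: openI; [exact: open_interior | exact: Uo].
  apply/seteqP; split=> [p [VWp [[y [V' W']] Ss' /= yp]]|_ ->] /=; last first.
    by split=> //; exists (x, (V, W)).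
  move: VWp; rewrite -{p}yp => -[Vy Wy].
  have [UV' UW' V'y W'y] := S1 _ _ _ Ss'.
  have [[->//]|ne] := pselect ((y, (V', W')) = (x, (V, W))).
  have [/= W'V|/= WV'] := S2 _ _ Ss' Ss ne.
    by have := interior_subset Vy (W'V _ W'y).
  by have := interior_subset V'y (WV' _ Wy).
- move=> A UA DA.
  (* Unboundedness is used twice: [W] exceeds [A], then [W'] exceeds [W]. The gap condition then
     forces [W] into [V'], so [y], lying outside [V'], is a point of [D] outside [A]. *)
  have [[x [V W]] Ss /= WA] := Sub A UA; have [UV UW Vx Wx] := S1 _ _ _ Ss.
  have [[y [V' W']] St /= W'W] := Sub W UW.
  have [UV' UW' V'y W'y] := S1 _ _ _ St.
  have AW : A `<=` W by have [] := Ut _ _ UA UW.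
  have [|/= WV'|/= W'V] := S2 _ _ Ss St.
  + by move=> [_ _ eW]; apply: W'W; rewrite eW.
  + apply: (interior_subset V'y); apply/WV'/AW/DA.
    by exists (y, (V', W')).
  + apply: W'W; apply: subset_trans W'V _.
    have [//|WV] := Ut _ _ UV UW.
    by case: (interior_subset Vx); exact: WV.
Qed.

Lemma od_Lindelof_chain (X : topologicalType) (K : Type) (U : set (set X)) :
  accessible_space X -> od_Lindelof X K ->
  U `<=` open -> total_on U subset ->
  (forall A, U A -> @isolated_point X `<=` A) -> is_cover U ->
  has_subcover_lt U K.
Proof.
move=> T1 /od_LindelofP od Uo Ut Ui Uc.
have [[A [UA dA]]|Und] := pselect (exists A, U A /\ dense A).
  have [||| V [VU Vc Vlt]] := od (U `&` [set B | A `<=` B]).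
  - by move=> B [/Uo].
  - move=> B [UB AB] O O0 Oo; have [x [Ox Ax]] := dA O O0 Oo.
    by exists x; split=> //; exact: AB.
  - apply/seteqP; split=> // x _.
    have [B UB Bx] : (\bigcup_(B in U) B) x by rewrite Uc.
    have [AB|BA] := Ut _ _ UA UB; first by exists B.
    by exists A; [split | exact: BA].
  - by exists V; split=> // B /VU[].
have {}Und A : U A -> ~ dense A by move=> UA dA; apply: Und; exists A.
have [D [Dni Ddisc Dub]] := ex_unbounded_discrete Uo Ut Ui Und Uc.
pose E (A : set X) := ~` closure (D `\` A).
(* [A] is open and disjoint from the part of [D] outside [A], hence from its closure. *)
have sub_E A : U A -> A `<=` E A.
  move=> UA; rewrite /E -interiorC -open_subsetE; last exact: Uo.
  by move=> y Ay [].
have [|C [CU Cc Clt]] := @has_subcover_lt_image _ _ U E K.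
  apply: od.
  - by move=> _ [A UA <-]; exact/closed_openC/closed_closure.
  - move=> _ [A UA <-]; apply: discrete_nonisolated_dense_closureC => //.
      by move=> x [/Dni].
    move=> x [Dx Ax]; have [O Oo OD] := Ddisc _ Dx.
    by exists O => //; rewrite setIDA OD; apply/seteqP; split=> [y []|_ ->].
  - apply/seteqP; split=> // x _.
    have [B UB Bx] : (\bigcup_(B in U) B) x by rewrite Uc.
    by exists (E B); [exists B | exact: sub_E].
exists C; split=> //; apply/seteqP; split=> // x _.
have [B UB Bx] : (\bigcup_(B in U) B) x by rewrite Uc.
have [d Dd nBd] : exists2 d, D d & ~ B d.
  apply: contrapT => h; apply: (Dub _ UB) => d Dd; apply: contrapT => nBd.
  by apply: h; exists d.
have [_ [A CA <-] EAd] : (\bigcup_(A in E @` C) A) d by rewrite Cc.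
exists A => //; have [AB|] := Ut _ _ (CU _ CA) UB; last exact.
by case: EAd; apply: subset_closure; split=> // /AB.
Qed.

Lemma od_Lindelof_nonisolated (X : topologicalType) (K : Type) :
  infinite_set [set: K] -> accessible_space X -> od_Lindelof X K ->
  linearly_Lindelof (nonisolated X) K.
Proof.
move=> infK T1 odX; apply/linearly_LindelofP => U Uo Ut Uc.
have [U0|/set0P[A0 UA0]] := eqVneq U set0.
  by exists U; split=> //; rewrite U0; exact: finite_card_lt.
(* [e A] is [A] together with all isolated points of [X]. *)
pose e (A : set (nonisolated X)) : set X := ~` (set_val @` (~` A)).
have eP A z : e A (set_val z) <-> A z.
  split=> [h|Az]; first by apply: contrapT => nAz; apply: h; exists z.
  by move=> [w nAw /val_inj wz]; apply: nAw; rewrite wz.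
have e_iso A (x : X) : isolated_point x -> e A x.
  by move=> xi [z _ zx]; apply: (set_valP z); rewrite -set_valE zx.
have iso_open : open (@isolated_point X).
  have -> : @isolated_point X = \bigcup_(x in @isolated_point X) [set x].
    by apply/seteqP; split=> [x xi|x [_ yi ->]//]; exists x.
  exact: bigcup_open.
have e_open A : open A -> open (e A).
  move=> [O Oo OA].
  have -> : e A = O `|` @isolated_point X; last exact: openU.
  apply/seteqP; split=> [x ex|x [Ox|]]; last exact: e_iso.
    have [|/ex_nonisolated[z zx]] := pselect (isolated_point x); first by right.
    left.
    by move: ex; rewrite -zx => /(eP _ _).1; rewrite -OA.
  by move=> [w nAw wx]; apply: nAw; rewrite -OA /= wx.
have [|C [CU Cc Clt]] := @has_subcover_lt_image _ _ U e K.
  apply: od_Lindelof_chain => //.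
  - by move=> _ [A UA <-]; exact/e_open/Uo.
  - move=> _ _ [A UA <-] [B UB <-].
    have e_mono A' B' : A' `<=` B' -> e A' `<=` e B'.
      by move=> AB x nx [w nBw wx]; apply: nx; exists w => // /AB.
    by have [AB|BA] := Ut _ _ UA UB; [left|right]; exact: e_mono.
  - by move=> _ [A UA <-] x; exact: e_iso.
  - apply/seteqP; split=> // x _.
    have [xi|/ex_nonisolated[z <-]] := pselect (isolated_point x).
      by exists (e A0); [exists A0 | exact: e_iso].
    have [A UA Az] : (\bigcup_(A in U) A) z by rewrite Uc.
    by exists (e A); [exists A | exact/eP].
exists C; split=> //; apply/seteqP; split=> // z _.
have [_ [A CA <-] /(eP _ _).1 Az] : (\bigcup_(B in e @` C) B) (set_val z).
  by rewrite Cc.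
by exists A.
Qed.

(** * From finite chain subcovers to compactness *)

Lemma finite_chain_ub (T : Type) (G C : set (set T)) :
  total_on G subset -> G !=set0 -> C `<=` G -> finite_set C ->
  exists2 M, G M & forall A, C A -> A `<=` M.
Proof.
move=> Gt [A0 GA0] + /finite_seqP[s Cs]; rewrite {}Cs.
elim: s => [|A s IH] sG; first by exists A0.
have [B Bs|M GM sM] := IH; first by apply: sG; rewrite /= inE Bs orbT.
have GA : G A by apply: sG; rewrite /= inE eqxx.
have [AM|MA] := Gt _ _ GA GM.
  by exists M => // B; rewrite /= inE => /orP[/eqP->//|]; exact: sM.
exists A => // B; rewrite /= inE => /orP[/eqP->//|/sM BM].
exact: subset_trans BM MA.
Qed.

(* If [U] has no finite subcover, take an open set maximal among those that no
   finite subfamily of [U] completes to the whole space: linear compactness makes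
   Zorn's lemma applicable, and adding to this set a member of [U] through a
   missing point contradicts maximality. *)
Lemma linearly_Lindelof_nat (X : topologicalType) :
  linearly_Lindelof X nat -> Lindelof X nat.
Proof.
move=> /linearly_LindelofP lin; apply/LindelofP => U Uo Uc.
apply: contrapT => noU.
pose Q (A : set X) := open A /\ forall F : set (set X),
  F `<=` U -> finite_set F -> A `|` \bigcup_(B in F) B <> [set: X].
have [|A [[Ao QA] Amax]] := @Zorn_bigcup _ Q.
  move=> G GQ Gt; split.
    by apply: bigcup_open => A /GQ[].
  move=> F FU finF GF.
  have [G0|/set0P[A0 GA0]] := eqVneq G set0.
    apply: noU; exists F; split=> //; last exact/card_lt_nat.
    by rewrite /is_cover -GF G0 bigcup_set0 set0U.
  (* If the union of the chain [G] together with [F] covers [X], the sets [f A] form a chain cover;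
     a common upper bound in [G] of the finitely many [A] retained already covers [X] together with
     [F]. *)
  pose f (A : set X) := A `|` \bigcup_(B in F) B.
  have Fo : open (\bigcup_(B in F) B) by apply: bigcup_open => B /FU/Uo.
  have [|C [CG Cc /card_lt_nat finC]] := @has_subcover_lt_image _ _ G f nat.
    apply: lin.
    - by move=> _ [A GA <-]; apply: openU => //; exact: (GQ _ GA).1.
    - move=> _ _ [A GA <-] [B GB <-].
      by have [AB|BA] := Gt _ _ GA GB; [left|right]; exact: setSU.
    - apply/seteqP; split=> // x _.
      have [[A GA Ax]|Fx] : ((\bigcup_(A in G) A) `|` \bigcup_(B in F) B) x.
          by rewrite GF.
        by exists (f A); [exists A | left].
      by exists (f A0); [exists A0 | right].
  have [M GM CM] := finite_chain_ub Gt (ex_intro _ A0 GA0) CG finC.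
  apply: ((GQ _ GM).2 F) => //; apply/seteqP; split=> // x _.
  have [_ [A CA <-] [Ax|Fx]] : (\bigcup_(B in f @` C) B) x by rewrite Cc.
    by left; exact: CM Ax.
  by right.
have [x Ax] : exists x, ~ A x.
  apply/existsNP => Aall; apply: (QA set0) => //.
  by rewrite bigcup_set0 setU0; apply/seteqP; split.
have [B UB Bx] : (\bigcup_(B in U) B) x by rewrite Uc.
apply: (Amax (A `|` B)); first by split; [left | move=> /(_ x (or_intror Bx))].
split; first by apply: openU => //; exact: Uo.
(* Completing the enlarged set by [F] amounts to completing [A] by [F] and [B], still a finite
   subfamily. *)
move=> F FU finF; rewrite -setUA -(bigcup_set1 id B) -bigcup_setU.
apply: QA; last by rewrite finite_setU.
by move=> C [->|/FU].
Qed.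

Theorem theorem5p1 (K : Type) (K_infinite : infinite_set [set: K]%classic)
    (K_regular : regular_cardinal K) :
  [/\ (forall X : topologicalType,
         accessible_space X -> od_Lindelof X K ->
         linearly_Lindelof (nonisolated X) K),
      (forall X : topologicalType,
         Lindelof (nonisolated X) K -> od_Lindelof X K)
    & (forall X : topologicalType,
         accessible_space X ->
         (od_compact X <-> L_compact (nonisolated X)))].
Proof.
split=> [X T1|X|X T1].
- exact: od_Lindelof_nonisolated.
- exact: Lindelof_nonisolated_od.
- split=> [odX|]; last exact/Lindelof_nonisolated_od/infinite_nat.
  exact/linearly_Lindelof_nat/od_Lindelof_nonisolated/odX/T1/infinite_nat.
Qed.
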